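(* Let $(L,[-,-]_1,[-,-]_2)$ be a compatible Leibniz algebra such that the two associated ternary Leibniz algebras, with brackets $[x,y,z]_i=[x,[y,z]_i]_i$ ($i=1,2$), are compatible, and let $\beta:L\to L$ be an injective linear map that is an averaging operator for both $[-,-]_1$ and $[-,-]_2$. Then $(L,[-,[-,-]_1^\beta]_1^\beta,[-,[-,-]_2^\beta]_2^\beta)$ is a compatible ternary Leibniz algebra, where $[x,y]_i^\beta=[\beta(x),y]_i$ for $x,y\in L$, $i=1,2$, and $[-,[-,-]_i^\beta]_i^\beta$ denotes the ternary bracket $(x,y,z)\mapsto[x,[y,z]_i^\beta]_i^\beta$.
   Context: Vector spaces are over a field $\mathbb{K}$. A Leibniz algebra is a vector space $L$ with a bilinear map $[-,-]:L\times L\to L$ such that $[[x,y],z]=[x,[y,z]]+[[x,z],y]$ for all $x,y,z\in L$. A compatible Leibniz algebra is a triple $(L,[-,-]_1,[-,-]_2)$ where both $(L,[-,-]_i)$ are Leibniz algebras and $$[[x,y]_1,z]_2+[[x,y]_2,z]_1=[x,[y,z]_1]_2+[x,[y,z]_2]_1+[[x,z]_1,y]_2+[[x,z]_2,y]_1.$$ An averaging operator on a Leibniz algebra is a linear map $\beta$ with $\beta([\beta(x),y])=[\beta(x),\beta(y)]=\beta([x,\beta(y)])$ for all $x,y$. A ternary Leibniz algebra is a vector space $L$ with a trilinear map $[-,-,-]$ such that $[[x,y,z],t,u]=[x,y,[z,t,u]]+[x,[y,t,u],z]+[[x,t,u],y,z]$. For any Leibniz algebra $(L,[-,-])$ the bracket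 $[x,[y,z]]$ makes $L$ a ternary Leibniz algebra, called the associated ternary Leibniz algebra. Two ternary Leibniz brackets on the same space are compatible (equivalently $(L,[-,-,-]_1,[-,-,-]_2)$ is a compatible ternary Leibniz algebra) if for all $x,y,z,t,u\in L$ $$[[x,y,z]_1,t,u]_2+[[x,y,z]_2,t,u]_1=[x,y,[z,t,u]_1]_2+[x,y,[z,t,u]_2]_1+[x,[y,t,u]_1,z]_2+[x,[y,t,u]_2,z]_1+[[x,t,u]_1,y,z]_2+[[x,t,u]_2,y,z]_1.$$ *)

(* Defs.v *)
From HB Require Import structures.
From mathcomp Require Import all_boot all_order all_algebra.

Set Implicit Arguments.
Unset Strict Implicit.
Unset Printing Implicit Defensive.

Import GRing.Theory.
Local Open Scope ring_scope.

Section Definitions.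

Variables (K : fieldType) (L : lmodType K).
Implicit Types (br : L -> L -> L) (t : L -> L -> L -> L).

Definition is_bilinear br : Prop := bilinear_for *:%R *:%R br.

Definition is_trilinear t : Prop :=
  [/\ forall y z, linear (fun x => t x y z),
      forall x z, linear (fun y => t x y z)
    & forall x y, linear (fun z => t x y z)].

Definition is_leibniz br : Prop :=
  is_bilinear br /\
  forall x y z, br (br x y) z = br x (br y z) + br (br x z) y.

Definition is_compatible_leibniz br1 br2 : Prop :=
  [/\ is_leibniz br1,
      is_leibniz br2
    & forall x y z,
        br2 (br1 x y) z + br1 (br2 x y) z =
          br2 x (br1 y z) + br1 x (br2 y z)
          + br2 (br1 x z) y + br1 (br2 x z) y].

Definition is_averaging br (beta : {linear L -> L}) : Prop :=
  forall x y, beta (br (beta x) y) = br (beta x) (beta y)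
              /\ br (beta x) (beta y) = beta (br x (beta y)).

Definition is_ternary_leibniz t : Prop :=
  is_trilinear t /\
  forall x y z u v,
    t (t x y z) u v = t x y (t z u v) + t x (t y u v) z + t (t x u v) y z.

Definition ternary_compatible t1 t2 : Prop :=
  forall x y z u v,
    t2 (t1 x y z) u v + t1 (t2 x y z) u v =
      t2 x y (t1 z u v) + t1 x y (t2 z u v)
      + t2 x (t1 y u v) z + t1 x (t2 y u v) z
      + t2 (t1 x u v) y z + t1 (t2 x u v) y z.

Definition is_compatible_ternary_leibniz t1 t2 : Prop :=
  [/\ is_ternary_leibniz t1, is_ternary_leibniz t2 & ternary_compatible t1 t2].

Definition associated_ternary br : L -> L -> L -> L :=
  fun x y z => br x (br y z).

Definition twisted_bracket (beta : {linear L -> L}) br : L -> L -> L :=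
  fun x y => br (beta x) y.

End Definitions.

(* Main.v *)
Require Import Defs.
From HB Require Import structures.
From mathcomp Require Import all_boot all_order all_algebra.

Import GRing.Theory.
Local Open Scope ring_scope.

(** The averaging identity [beta [beta x, y] = [beta x, beta y]] says that
    [beta] is a morphism from the twisted bracket to the original one; applied
    twice, it makes [beta] a morphism from the ternary bracket associated with
    the twisted bracket to the one associated with the original bracket
    ([averaging_ternary_morphism]). An injective linear map that is a morphism
    of ternary brackets pulls back every additive identity between composites
    of these brackets: apply the map to both sides, push it down to the
    variables, and conclude by injectivity. So the ternary Leibniz identity and
    the compatibility identity descend from the original brackets
    ([injective_morphism_ternary_leibniz],
    [injective_morphism_ternary_compatible]); for the original brackets the
    former follows from the Leibniz identity ([associated_ternary_leibniz]) and
    the latter is assumed. *)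

Section TernaryLeibniz.

Set Implicit Arguments.
Unset Strict Implicit.

Variables (K : fieldType) (L : lmodType K).
Implicit Types (br : L -> L -> L) (s t : L -> L -> L -> L).
Implicit Types (beta : {linear L -> L}).

Lemma associated_ternary_trilinear br :
  is_bilinear br -> is_trilinear (associated_ternary br).
Proof.
case=> linl linr; split=> a b c u v; rewrite /associated_ternary.
- exact: linl.
- by rewrite linl linr.
- by rewrite !linr.
Qed.

Lemma twisted_bracket_bilinear br beta :
  is_bilinear br -> is_bilinear (twisted_bracket beta br).
Proof.
case=> linl linr; split=> a c u v; rewrite /= /twisted_bracket.
- by rewrite linearP linl.
- exact: linr.
Qed.

(** By the Leibniz identity, right multiplication by any [w] is a derivation
    of the bracket, hence of its iterates; the ternary identity is this
    property of [[x, [y, z]]] for [w = [u, v]]. *)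
Lemma associated_ternary_leibniz br :
  is_leibniz br -> is_ternary_leibniz (associated_ternary br).
Proof.
case=> bil leib; split; first exact: associated_ternary_trilinear.
have [_ linr] := bil.
have brDr x y z : br x (y + z) = br x y + br x z.
  by have := linr x 1 y z; rewrite /= !scale1r.
by move=> x y z u v; rewrite /associated_ternary leib (leib y) brDr.
Qed.

Lemma averaging_ternary_morphism br beta :
  is_averaging br beta ->
  forall x y z,
    beta (associated_ternary (twisted_bracket beta br) x y z) =
    associated_ternary br (beta x) (beta y) (beta z).
Proof.
move=> avg x y z; rewrite /associated_ternary /twisted_bracket.
by rewrite (avg x _).1 (avg y z).1.
Qed.

Lemma injective_morphism_ternary_leibniz beta s t :
  injective beta ->
  (forall x y z, beta (s x y z) = t (beta x) (beta y) (beta z)) ->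
  is_trilinear s -> is_ternary_leibniz t -> is_ternary_leibniz s.
Proof.
move=> inj_beta betaM s_lin [_ leib]; split=> // x y z u v.
by apply: inj_beta; rewrite !linearD !betaM leib.
Qed.

Lemma injective_morphism_ternary_compatible beta s1 s2 t1 t2 :
  injective beta ->
  (forall x y z, beta (s1 x y z) = t1 (beta x) (beta y) (beta z)) ->
  (forall x y z, beta (s2 x y z) = t2 (beta x) (beta y) (beta z)) ->
  ternary_compatible t1 t2 -> ternary_compatible s1 s2.
Proof.
move=> inj_beta betaM1 betaM2 compat x y z u v.
by apply: inj_beta; rewrite !linearD !(betaM1, betaM2) compat.
Qed.

Lemma twisted_ternary_leibniz br beta :
  injective beta -> is_averaging br beta -> is_leibniz br ->
  is_ternary_leibniz (associated_ternary (twisted_bracket beta br)).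
Proof.
move=> inj_beta avg leib.
apply: (injective_morphism_ternary_leibniz inj_beta
         (averaging_ternary_morphism avg)).
- apply: associated_ternary_trilinear; apply: twisted_bracket_bilinear.
  exact: leib.1.
- exact: associated_ternary_leibniz.
Qed.

End TernaryLeibniz.

Theorem corollary3p1 (K : fieldType) (L : lmodType K)
    (br1 br2 : L -> L -> L) (beta : {linear L -> L})
    (h_compat : is_compatible_leibniz br1 br2)
    (h_ternary : ternary_compatible (associated_ternary br1)
                                    (associated_ternary br2))
    (h_inj : injective beta)
    (h_avg1 : is_averaging br1 beta)
    (h_avg2 : is_averaging br2 beta) :
  is_compatible_ternary_leibniz
    (associated_ternary (twisted_bracket beta br1))
    (associated_ternary (twisted_bracket beta br2)).
Proof.
case: h_compat => leib1 leib2 _; split.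
- exact: twisted_ternary_leibniz.
- exact: twisted_ternary_leibniz.
- exact: (injective_morphism_ternary_compatible h_inj
           (averaging_ternary_morphism h_avg1)
           (averaging_ternary_morphism h_avg2)).
Qed.
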